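(* Let $a>b>0$ and $m\ge 1$ be integers, and let $f_0$ be defined by $f_0(1)=1$, $f_0(2)=a$, and $f_0(n+2)=af_0(n+1)-bf_0(n)$ for $n\ge 1$. Let $c_m(n,k)$ be the function associated with $f_0$ as in the context. Then, for $1\le k\le n$, the number $c_m(n,k)$ is the number of words of length $n-1$ over the alphabet $\{0,1,\ldots,b-1,b,\ldots,m+a-1\}$ having exactly $k-1$ letters equal to $m+a-1$ and avoiding the subwords $0j$, $j=1,2,\ldots,b$.
   Context: For an arithmetic function $f_0$ defined on the positive integers, define recursively for $m\ge 1$ and $1\le k\le n$: $c_m(n,k)=\sum_{i_1+\cdots+i_k=n} f_{m-1}(i_1)\cdots f_{m-1}(i_k)$, the sum over positive integers $i_1,\ldots,i_k$, and $f_m(n)=\sum_{k=1}^n c_m(n,k)$. A subword means a block of consecutive letters; avoiding $0j$ means that the letter $0$ is never immediately followed by the letter $j$. *)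

(* Defs.v *)
From HB Require Import structures.
From mathcomp Require Import all_boot all_order all_algebra.

Set Implicit Arguments.
Unset Strict Implicit.
Unset Printing Implicit Defensive.

Import GRing.Theory.
Local Open Scope ring_scope.

(* Arithmetic functions are functions on nat whose value at 0 is never used.
   Each part of a composition of n is at most n, so ranging over 'I_n.+1 loses
   no composition. *)
Definition comp_sum (R : pzSemiRingType) (g : nat -> R) (n k : nat) : R :=
  \sum_(t : k.-tuple 'I_n.+1 |
        [forall j, (0 < tnth t j)%N] && ((\sum_(j < k) tnth t j)%N == n))
     \prod_(j < k) g (tnth t j).

Fixpoint iter_f (R : pzSemiRingType) (f0 : nat -> R) (m : nat) : nat -> R :=
  if m is m'.+1 then
    fun n => \sum_(1 <= k < n.+1) comp_sum (iter_f f0 m') n k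
  else f0.

(* Meaningful for m >= 1 only. *)
Definition iter_c (R : pzSemiRingType) (f0 : nat -> R) (m n k : nat) : R :=
  comp_sum (iter_f f0 m.-1) n k.

Definition avoids (b : nat) (s : seq nat) : bool :=
  all (fun j => ~~ infix [:: 0%N; j] s) (iota 1 b).

(* 'I_q is the alphabet {0, ..., q - 1}; its largest letter is q.-1. *)
Definition words (q b len r : nat) : {set len.-tuple 'I_q} :=
  [set w : len.-tuple 'I_q |
     (count_mem q.-1 (map val w) == r) && avoids b (map val w)].

(* Main.v *)
Require Import Defs.
From mathcomp Require Import all_boot all_order all_algebra.
From mathcomp Require Import zify ring.

Set Implicit Arguments.
Unset Strict Implicit.
Unset Printing Implicit Defensive.

Import GRing.Theory.

Local Open Scope ring_scope.

(** Write F_m for the generating function of f_m. The recurrence on f_0 says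
    that F_0 = x / (1 - a x + b x^2), and f_(m+1) = sum_k c_(m+1)(_, k) means
    F_(m+1) = F_m / (1 - F_m); hence F_m = x / (1 - (a + m) x + b x^2): each
    step keeps the shape of the recurrence and adds 1 to its first coefficient.

    If F = x / (1 - A x + B x^2), the numbers c(n, k) = [x^n] F^k are best
    collected by a second variable X marking k: the row polynomials
    p_n = sum_k c(n+1, k+1) X^k have generating function
    1 / (1 - (A + X) x + B x^2), that is
      p_0 = 1,  p_1 = A + X,  p_(n+2) = (A + X) p_(n+1) - B p_n
    (comp_poly0, comp_poly1, comp_polySS). Setting X = 1 gives the sum over k,
    which is why the next f obeys the recurrence with A + 1 (linrec_iter_f).

    On the other side, let w_n enumerate by the number of letters A the words
    of length n over {0, ..., A} that avoid 01, ..., 0b. Prefixing a letter to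
    a word of length n+1 contributes the factor A + X, except that the prefix 0
    is forbidden when the word starts with one of 1, ..., b; when b < A these
    first letters are neither 0 nor A, so removing them leaves an arbitrary
    admissible word of length n of the same weight, and b w_n has to be
    subtracted (word_enumSS). So w_n and p_n satisfy the same recursion with
    the same initial values, and comparing coefficients for A = a + m - 1
    gives the result. *)

(** * Compositions as coefficients of powers *)

Section Compositions.

Variable R : comNzRingType.

Definition trunc_gf (g : nat -> R) (N : nat) : {poly R} :=
  \poly_(i < N.+1) (if i is 0%N then 0 else g i).

(** Expanding the k-th power of the generating polynomial chooses one part for
    each factor; the constant coefficient is set to 0 so that zero parts, which
    the tuples of ordinals allow, contribute nothing. *)
Lemma comp_sum_coef_trunc (g : nat -> R) (n k : nat) :
  comp_sum g n k = (trunc_gf g n ^+ k)`_n.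
Proof.
(* The power is written as a product over 'I_k, to be distributed over sums. *)
rewrite -[k in RHS]card_ord -prodr_const /trunc_gf.
under eq_bigr do rewrite poly_def.
rewrite bigA_distr_bigA coef_sum /comp_sum big_mkcond /=.
rewrite (reindex (@tuple_of_finfun 'I_n.+1 k)) /=; last first.
  by exists (@finfun_of_tuple _ _) => t _;
    [exact: tuple_of_finfunK | exact: finfun_of_tupleK].
apply: eq_bigr => f _.
have tnthE j : tnth (tuple_of_finfun f) j = f j by rewrite tnth_mktuple.
under eq_forallb do rewrite tnthE.
under [X in _ && (X == _)]eq_bigr do rewrite tnthE.
under [X in if _ then X else _]eq_bigr do rewrite tnthE.
rewrite scaler_prod prodrXr coefZ coefXn.
case: forallP => [f_gt0 | /forallP/forallPn[j]] /=; last first.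
  by rewrite -eqn0Ngt => /eqP fj0; rewrite (bigD1 j) //= fj0 !mul0r.
rewrite eq_sym; case: eqP => _; rewrite ?mulr0 // mulr1.
by apply: eq_bigr => j _; case: (nat_of_ord (f j)) (f_gt0 j).
Qed.

Lemma coefM_low (N : nat) (p q r s : {poly R}) :
  (forall i, (i <= N)%N -> p`_i = q`_i) ->
  (forall i, (i <= N)%N -> r`_i = s`_i) ->
  forall i, (i <= N)%N -> (p * r)`_i = (q * s)`_i.
Proof.
move=> eq_pq eq_rs i le_iN; rewrite !coefM; apply: eq_bigr => j _.
by rewrite eq_pq ?eq_rs //; have := ltn_ord j; lia.
Qed.

(** A common truncation order for all the values of n in an identity lets the
    identity be read off from a single polynomial equation. *)
Lemma comp_sum_coef (g : nat -> R) (N n k : nat) :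
  (n <= N)%N -> comp_sum g n k = (trunc_gf g N ^+ k)`_n.
Proof.
move=> le_nN; rewrite comp_sum_coef_trunc.
have low i : (i <= n)%N -> (trunc_gf g n ^+ k)`_i = (trunc_gf g N ^+ k)`_i.
  elim: k i => [|k IHk] i le_in; first by rewrite !expr0.
  rewrite !exprS; apply: (coefM_low (N := n)) le_in => // j le_jn.
  by rewrite /trunc_gf !coef_poly !ltnS le_jn (leq_trans le_jn le_nN).
exact: low.
Qed.

Lemma comp_sum_gt (g : nat -> R) (n k : nat) : (n < k)%N -> comp_sum g n k = 0.
Proof.
move=> lt_nk; rewrite comp_sum_coef_trunc.
(* The zero constant coefficient makes the k-th power divisible by 'X^k. *)
have -> : trunc_gf g n = 'X * \poly_(i < n) g i.+1.
  by apply/polyP=> i; rewrite coefXM !coef_poly; case: i.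
by rewrite exprMn coefXnM lt_nk.
Qed.

Lemma comp_sum0 (g : nat -> R) (n : nat) : comp_sum g n 0 = (n == 0%N)%:R.
Proof. by rewrite comp_sum_coef_trunc expr0 coef1. Qed.

(** * The recursion of the row polynomials *)

Definition linrec (A B : R) (g : nat -> R) : Prop :=
  [/\ g 1%N = 1, g 2%N = A &
      forall n, (1 <= n)%N -> g n.+2 = A * g n.+1 - B * g n].

(** With D = 1 - A x + B x^2, the recurrence says D F = x, so D F^(k+1) = x F^k;
    this is the coefficient of x^(n+2), where F may be truncated. *)
Lemma comp_sum_rec (A B : R) (g : nat -> R) : linrec A B g ->
  forall n k : nat,
  comp_sum g n.+2 k.+1 = A * comp_sum g n.+1 k.+1 - B * comp_sum g n k.+1
                         + comp_sum g n.+1 k.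
Proof.
move=> [g1 g2 grec] n k.
rewrite !(@comp_sum_coef g n.+2) //; last by lia.
set P := trunc_gf g n.+2.
pose D : {poly R} := 1 - A *: 'X + B *: 'X^2.
have low i : (i <= n.+2)%N -> (D * P)`_i = 'X`_i.
  rewrite /D !mulrDl mul1r mulNr -!scalerAl !(coefD, coefN, coefZ) coefXM.
  rewrite coefXnM coefX !coef_poly => le_i.
  have -> : (i.-1 < n.+3)%N by lia.
  have -> : (i - 2 < n.+3)%N by lia.
  rewrite ltnS le_i; case: i le_i => [|[|[|i]]] _ /=.
  - by ring.
  - by rewrite g1; ring.
  - by rewrite g1 g2; ring.
  - by rewrite subn2 /= grec //; ring.
have := coefM_low low (fun i _ => erefl (P ^+ k)`_i) (leqnn n.+2).
rewrite coefXM -mulrA -exprS /D !mulrDl mul1r mulNr -!scalerAl.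
rewrite !(coefD, coefN, coefZ) coefXM coefXnM /= subn2 /= => <-.
by ring.
Qed.

(** Both indices are shifted because a word of length n with k marked letters
    corresponds to n + 1 split into k + 1 parts. *)
Definition comp_poly (g : nat -> R) (n : nat) : {poly R} :=
  \poly_(k < n.+1) comp_sum g n.+1 k.+1.

Lemma coef_comp_poly (g : nat -> R) (n k : nat) :
  (comp_poly g n)`_k = comp_sum g n.+1 k.+1.
Proof.
by rewrite coef_poly; case: ltnP => // lt_nk; rewrite comp_sum_gt // ltnS.
Qed.

Lemma comp_poly0 (A B : R) (g : nat -> R) : linrec A B g -> comp_poly g 0 = 1.
Proof.
case=> g1 _ _; apply/polyP=> k.
rewrite coef_comp_poly coef1; case: k => [|k]; last by rewrite comp_sum_gt.
by rewrite comp_sum_coef_trunc expr1 coef_poly /= g1.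
Qed.

Lemma comp_poly1 (A B : R) (g : nat -> R) :
  linrec A B g -> comp_poly g 1 = A%:P + 'X.
Proof.
move=> gP; apply/polyP=> k.
rewrite coef_comp_poly (comp_sum_rec gP) -coef_comp_poly (comp_poly0 gP).
rewrite coef1 (comp_sum_gt _ (ltn0Sn k)) coefD coefC coefX.
case: k => [|k]; first by rewrite comp_sum0 /=; ring.
by rewrite -coef_comp_poly (comp_poly0 gP) coef1 eqSS /=; ring.
Qed.

Lemma comp_polySS (A B : R) (g : nat -> R) (n : nat) : linrec A B g ->
  comp_poly g n.+2 = (A%:P + 'X) * comp_poly g n.+1 - B%:P * comp_poly g n.
Proof.
move=> gP; apply/polyP=> k.
rewrite mulrDl !(coefD, coefN) !coefCM coefXM !coef_comp_poly.
rewrite (comp_sum_rec gP); case: k => [|k] /=; first by rewrite comp_sum0 /=; ring.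
by ring.
Qed.

Lemma iter_fS (f0 : nat -> R) (m n : nat) :
  iter_f f0 m.+1 n.+1 = (comp_poly (iter_f f0 m) n).[1].
Proof.
rewrite horner_poly /= big_add1 big_mkord.
by apply: eq_bigr => k _; rewrite expr1n mulr1.
Qed.

(** Evaluation at X = 1 turns the coefficient A + X of the recursion of the row
    polynomials into A + 1. *)
Lemma linrec_iter_f (A B : R) (f0 : nat -> R) (m : nat) :
  linrec A B f0 -> linrec (A + m%:R) B (iter_f f0 m).
Proof.
move=> f0P; elim: m => [|m IHm]; first by rewrite addr0.
have -> : A + m.+1%:R = A + m%:R + 1 by rewrite -natr1 addrA.
split=> [||[//|n] _]; rewrite !iter_fS.
- by rewrite (comp_poly0 IHm) hornerE.
- by rewrite (comp_poly1 IHm) !hornerE.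
- by rewrite (comp_polySS _ IHm) !hornerE.
Qed.

End Compositions.

(** * Words by first letter *)

Lemma sum_tuple0 (V : nmodType) (T : finType) (F : seq T -> V) :
  \sum_(t : 0.-tuple T) F t = F [::].
Proof.
by rewrite (big_pred1 [tuple]) // => t; apply/esym/eqP/tuple0.
Qed.

Lemma sum_tuple_cons (V : nmodType) (T : finType) (n : nat) (F : seq T -> V) :
  \sum_(t : n.+1.-tuple T) F t = \sum_(x : T) \sum_(t : n.-tuple T) F (x :: t).
Proof.
rewrite pair_big (reindex (fun p : T * n.-tuple T => [tuple of p.1 :: p.2])) //=.
exists (fun t => (thead t, [tuple of behead t])) => [[x t] _ | t _] /=.
  by congr pair; apply: val_inj.
by case/tupleP: t => x t; apply: val_inj.
Qed.

(** Prefixing a letter creates at most one new factor of length 2, formed with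
    the first letter of the word. The default value 0 of head makes the empty
    word harmless, since 0 is not among the letters 1, ..., b. *)
Lemma avoids_cons (b x : nat) (s : seq nat) :
  avoids b (x :: s) = avoids b s && ~~ ((x == 0%N) && (0 < head 0%N s <= b)%N).
Proof.
rewrite /avoids andbC.
under eq_all do rewrite infix_consl negb_or.
rewrite all_predI; congr andb.
case: s => [|y s] /=.
  by case: x => [|x] /=; apply/allP => j _ /=; rewrite ?andbF.
have -> : (0 < y <= b)%N = (y \in iota 1 b) by rewrite mem_iota; lia.
rewrite [x == _]eq_sym; case: (0 =P x)%N => /= _; last by apply/allP.
rewrite -has_pred1 -all_predC.
by apply: eq_all => j /=; rewrite prefix0s andbT eq_sym.
Qed.

(** * The enumerator of words avoiding 01, ..., 0b *)

Section Words.

Variables (A b : nat).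

Definition word_weight (s : seq nat) : {poly int} :=
  if avoids b s then 'X^(count_mem A s) else 0.

Definition word_enum (n : nat) : {poly int} :=
  \sum_(w : n.-tuple 'I_A.+1) word_weight (map val w).

Lemma coef_word_enum (n r : nat) :
  (word_enum n)`_r = #|words A.+1 b n r|%:Z.
Proof.
rewrite coef_sum -sum1_card -natz natr_sum [RHS]big_mkcond /=.
apply: eq_bigr => w _; rewrite inE /word_weight /= eq_sym.
case: avoids; rewrite ?coef0 ?andbF // coefXn andbT.
by case: eqP.
Qed.

Lemma word_weight_cons (x : nat) (s : seq nat) :
  word_weight (x :: s) =
    if (x == 0%N) && (0 < head 0%N s <= b)%N then 0
    else 'X^(x == A) * word_weight s.
Proof.
rewrite /word_weight avoids_cons.
by case: ((x == 0%N) && _); case: avoids => /=; rewrite ?mulr0 ?exprD.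
Qed.

Lemma sum_Xn_eq : \sum_(x < A.+1) 'X^(x == A :> nat) = A%:R + 'X :> {poly int}.
Proof.
rewrite big_ord_recr /= eqxx expr1; congr (_ + _).
rewrite (eq_bigr (fun=> 1)) ?sumr_const ?card_ord // => i _.
by rewrite ltn_eqF.
Qed.

Lemma word_enum0 : word_enum 0 = 1.
Proof.
rewrite /word_enum (sum_tuple0 (fun s => word_weight (map val s))).
by rewrite /word_weight /= ifT //; apply/allP.
Qed.

Lemma word_enum1 : word_enum 1 = A%:R + 'X.
Proof.
rewrite /word_enum (sum_tuple_cons _ (fun s => word_weight (map val s))) -sum_Xn_eq.
apply: eq_bigr => x _ /=.
rewrite (sum_tuple0 (fun s => word_weight (val x :: map val s))) word_weight_cons.
by rewrite /= andbF /word_weight /= ifT ?mulr1 //; apply/allP.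
Qed.

Hypothesis lt_bA : (b < A)%N.

(** Since b < A, a first letter in 1, ..., b is neither the marked letter A nor
    the letter 0, so deleting it changes neither the weight nor the
    admissibility: each of the b letters contributes the whole enumerator. *)
Lemma sum_word_weight_bad (n : nat) :
  \sum_(t : n.+1.-tuple 'I_A.+1 | (0 < head 0%N (map val t) <= b)%N)
     word_weight (map val t) = b%:R * word_enum n.
Proof.
rewrite big_mkcond /=.
rewrite (sum_tuple_cons _ (fun s => if (0 < head 0%N (map val s) <= b)%N
                                 then word_weight (map val s) else 0)) /=.
transitivity (\sum_(y < A.+1 | (0 < y <= b)%N) word_enum n).
  rewrite [RHS]big_mkcond; apply: eq_bigr => y _.
  case: ifP => [y_bad|_]; last by rewrite big1.
  apply: eq_bigr => t _; rewrite word_weight_cons.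
  have /negPf-> : nat_of_ord y != 0%N by lia.
  by have /negPf-> : nat_of_ord y != A; [lia | rewrite /= mul1r].
rewrite big_mkcond big_ord_recl /= add0r -big_mkcond /=.
rewrite -(big_ord_widen A (fun=> word_enum n)) 1?ltnW //.
by rewrite sumr_const card_ord mulr_natl.
Qed.

(** If every letter could precede every admissible word, the enumerator would
    be (A + X) w_(n+1); the excess consists of the letter 0 followed by a word
    beginning with one of 1, ..., b. *)
Lemma word_enumSS (n : nat) :
  word_enum n.+2 = (A%:R + 'X) * word_enum n.+1 - b%:R * word_enum n.
Proof.
rewrite {1}/word_enum (sum_tuple_cons _ (fun s => word_weight (map val s))) /=.
under eq_bigr do under eq_bigr do rewrite word_weight_cons.
(* Only the summand of the first letter 0 differs on the two sides. *)
rewrite -sum_Xn_eq -sum_word_weight_bad mulr_suml !big_ord_recl addrAC /=.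
congr (_ + _); last by apply: eq_bigr => x _; rewrite -mulr_sumr.
have /negPf-> : 0%N != A by lia.
rewrite mul1r /word_enum [in RHS](bigID (fun t : n.+1.-tuple 'I_A.+1 =>
  (0 < head 0%N (map val t) <= b)%N)) /= addrC addKr [RHS]big_mkcond /=.
by apply: eq_bigr => t _; rewrite mul1r; case: ifP.
Qed.

Lemma comp_poly_word_enum (g : nat -> int) (n : nat) :
  linrec A%:R b%:R g -> comp_poly g n = word_enum n.
Proof.
move=> gP.
suff: comp_poly g n = word_enum n /\ comp_poly g n.+1 = word_enum n.+1 by case.
elim: n => [|n [IHn IHn1]].
  by rewrite (comp_poly0 gP) (comp_poly1 gP) word_enum0 word_enum1 polyC_natr.
by rewrite (comp_polySS _ gP) word_enumSS IHn IHn1 !polyC_natr.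
Qed.

End Words.

Theorem corollary7 (a b m : nat) (f0 : nat -> int)
  (hb : (0 < b)%N) (hab : (b < a)%N) (hm : (1 <= m)%N)
  (hf1 : f0 1%N = 1)
  (hf2 : f0 2%N = a%:Z)
  (hf : forall n : nat, (1 <= n)%N ->
          f0 n.+2 = a%:Z * f0 n.+1 - b%:Z * f0 n) :
  forall n k : nat, (1 <= k)%N -> (k <= n)%N ->
    iter_c f0 m n k = #|words (m + a) b (n - 1) (k - 1)|%:Z.
Proof.
move=> [|n] [|k] // _ _; rewrite !subn1 /=.
case: m hm => [//|m] _; rewrite addSn -coef_word_enum /iter_c /= -coef_comp_poly.
have fmP : linrec (m + a)%:R b%:R (iter_f f0 m).
  by rewrite natrD addrC; apply: linrec_iter_f; split=> //; rewrite ?natz.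
have lt_bA : (b < m + a)%N by lia.
by rewrite (comp_poly_word_enum lt_bA _ fmP).
Qed.
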